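(* Let $G$ be a graph with at least two vertices having an independent $[1,2]$-set. Then there exists a spanning tree $T$ of $G$ satisfying $T\in\mathcal{F}_2$ and having a generating family $\mathcal{G}(T)=\{T_1,\dots,T_t\}$, with $V(T_j)=X_j\cup Y_j$ the bipartition of $T_j$ into a $p_2$-set $X_j$ and an independent $[1,2]$-set $Y_j$ (for $j=1,\dots,t$), such that every edge $e\in E(G)\setminus E(T)$ satisfies one of the following: either both endpoints of $e$ belong to $\bigcup_{j=1}^{t}X_j$ (type A edge), or the endpoints of $e$ can be named $u,v$ (so $e=uv$) in such a way that there exists $j_e\in\{1,\dots,t\}$ for which $u$ is a leaf of $T_{j_e}$, $u\in X_{j_e}$ and $v\in Y_{j_e}$ (type B edge).
   Context: All graphs are finite, undirected, simple and connected. For a graph $G=(V,E)$ and $v\in V$, $N(v)$ is the set of neighbors of $v$. A set $S\subseteq V$ is an independent $[1,2]$-set of $G$ if no two vertices of $S$ are adjacent and every vertex $v\in V\setminus S$ satisfies $1\le |N(v)\cap S|\le 2$. A leaf is a vertex of degree $1$. A $p_2$-tree is a non-trivial tree (at least two vertices) such that, in the unique bipartition of its vertex set into two partite sets, every vertex in one of the partite sets has degree at most $2$ (in that tree); such a partite set is called a $p_2$-set. If $V(T)=X\cup Y$ is the bipartition and $X$ is a $p_2$-set, then $Y$ is an independent $[1,2]$-set of $T$. A generating family of a tree $T$ is a family $\mathcal{G}(T)=\{T_1,\dots,T_t\}$ ($t\ge 1$) of pairwise vertex-disjoint $p_2$-trees, each with a bipartition $V(T_i)=X_i\cup Y_i$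 in which $X_i$ is a $p_2$-set of $T_i$, such that $T$ is obtained from the disjoint union of $T_1,\dots,T_t$ by adding $t-1$ edges, each of which joins vertices in two different sets $X_i$ and $X_j$ ($i\ne j$). $\mathcal{F}_2$ denotes the family of trees having a generating family. *)

(* Defs.v *)
From mathcomp Require Import all_boot.

Set Implicit Arguments.
Unset Strict Implicit.
Unset Printing Implicit Defensive.

(* Vertices are drawn from an ambient finite type [U], so that a graph, its
   spanning trees and the vertex-disjoint pieces of such a tree all have the
   same type. Edges are two-element sets of vertices, which excludes loops and
   multiple edges. *)
Record graph (U : finType) := Graph {
  vset : {set U};
  eset : {set {set U}};
  esetP : [forall e in eset, (#|e| == 2) && (e \subset vset)]
}.

Section Graphs.
Variable U : finType.
Implicit Types (G T : graph U) (S X Y : {set U}).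

Definition adj G : rel U := fun x y => [set x; y] \in eset G.

Definition nbrs G (x : U) : {set U} := [set y | adj G x y].

Definition deg G (x : U) : nat := #|nbrs G x|.

Definition leaf G (x : U) : Prop := x \in vset G /\ deg G x = 1.

Definition connected_graph G : Prop :=
  vset G != set0 /\ {in vset G &, forall x y, connect (adj G) x y}.

Definition acyclic G : Prop :=
  forall c : seq U, uniq c -> 3 <= size c -> ~~ cycle (adj G) c.

Definition tree G : Prop := connected_graph G /\ acyclic G.

Definition independent G S : Prop :=
  S \subset vset G /\ {in S &, forall x y, ~~ adj G x y}.

Definition independent12 G S : Prop :=
  independent G S /\
  {in vset G :\: S, forall v, 1 <= #|nbrs G v :&: S| <= 2}.

Definition bipartition G X Y : Prop :=
  [/\ X :|: Y = vset G, [disjoint X & Y], independent G X & independent G Y].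

Definition p2_bipartition T X Y : Prop :=
  bipartition T X Y /\ {in X, forall x, deg T x <= 2}.

Definition p2_tree T : Prop :=
  [/\ tree T, 2 <= #|vset T| & exists X Y, p2_bipartition T X Y].

Definition spanning_tree G T : Prop :=
  [/\ vset T = vset G, eset T \subset eset G & tree T].

(* [F] is the set of added edges. Each of them joins two different pieces, so
   [F] is automatically disjoint from the edge sets of the pieces. *)
Definition generating_family T (t : nat)
    (Ts : 'I_t -> graph U) (X Y : 'I_t -> {set U}) : Prop :=
  [/\ 1 <= t,
      forall i, p2_tree (Ts i) /\ p2_bipartition (Ts i) (X i) (Y i),
      forall i j, i != j -> [disjoint vset (Ts i) & vset (Ts j)],
      vset T = \bigcup_i vset (Ts i)
    & exists F : {set {set U}},
        [/\ eset T = (\bigcup_i eset (Ts i)) :|: F,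
            #|F| = t - 1
          & forall f, f \in F -> exists i j x y,
              [/\ i != j, x \in X i, y \in X j & f = [set x; y]]]].

Definition F2 T : Prop :=
  tree T /\ exists t (Ts : 'I_t -> graph U) (X Y : 'I_t -> {set U}),
    generating_family T Ts X Y.

Definition typeA (t : nat) (X : 'I_t -> {set U}) (e : {set U}) : Prop :=
  e \subset \bigcup_j X j.

Definition typeB (t : nat) (Ts : 'I_t -> graph U) (X Y : 'I_t -> {set U})
    (e : {set U}) : Prop :=
  exists u v j, [/\ e = [set u; v], leaf (Ts j) u, u \in X j & v \in Y j].

End Graphs.

(* Main.v *)
Require Import Defs.
From mathcomp Require Import all_boot.

Set Implicit Arguments.
Unset Strict Implicit.
Unset Printing Implicit Defensive.

(** Let [S] be an independent [1,2]-set of [G] and call an edge of [G] a star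
    edge if it meets [S]. Since [S] is independent, each star edge has exactly
    one end in [S], and since a vertex outside [S] has one or two neighbours in
    [S], it lies on one or two star edges. A vertex of [S] lies on a star edge
    too, because [G] is connected and nontrivial.

    Take a maximal forest [F0] among the star edges. Its components have the
    same vertex sets as those of the graph of all star edges, and each of them
    is a nontrivial tree in which the vertices outside [S] form a p2-set: these
    components are the pieces [Ts i], with [X i] the part outside [S] and [Y i]
    the part inside. Then extend [F0] by a set [F] of edges of [G] to a spanning
    tree of [G]. An edge of [F] joins two different pieces, so it is not a star
    edge, and both of its ends lie in the sets [X i]. Each added edge
    merges two components, whence [#|F| = t - 1].

    An edge of [G] outside the tree that misses [S] is of type A. The other
    ones are star edges [uv] with [v] in [S] and [u] outside. By maximality of
    [F0], both ends lie in one piece; and [u] lies on at most two star edges,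
    one of which, [uv], is not in [F0], so [u] is a leaf of its piece: this is
    type B.

    Both forests come from the same lemma [extend_forest], which extends a
    forest [E0] inside [E] until it has the components of [E], and counts the
    added edges. It rests on [eacyclicU1] and [card_ecompsU1], which describe
    the effect of one edge joining two components. *)

(** * Forests as sets of edges *)

Section EdgeSets.
Variables (U : finType) (V : {set U}).
Implicit Types (E F : {set {set U}}) (x y : U).

(** This is the condition on the edges of a graph with vertex set [V]. The
    notions below are those of [adj] and [acyclic], for a bare edge set, so that
    adding edges one at a time needs no graph to be rebuilt. *)
Definition edges_on E := [forall e in E, (#|e| == 2) && (e \subset V)].

Definition eadj E : rel U := fun x y => [set x; y] \in E.

Definition eacyclic E : Prop :=
  forall c : seq U, uniq c -> 3 <= size c -> ~~ cycle (eadj E) c.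

Definition ecomp E x : {set U} := [set y | connect (eadj E) x y].

Definition ecomps E : {set {set U}} := [set ecomp E x | x in V].

Lemma edges_onS E F : E \subset F -> edges_on F -> edges_on E.
Proof.
by move=> sEF /forall_inP onF; apply/forall_inP=> e /(subsetP sEF)/onF.
Qed.

Lemma edge_ends E x y : edges_on E -> eadj E x y ->
  [/\ x != y, x \in V & y \in V].
Proof.
move=> /forall_inP onE /onE; rewrite cards2 subUset !sub1set.
by case: (x != y) => // /andP[_ /andP[-> ->]].
Qed.

Lemma edge_pair E e : edges_on E -> e \in E -> exists x y, e = [set x; y].
Proof.
by move=> /forall_inP onE /onE/andP[/cards2P[x [y [_ ->]]] _]; exists x, y.
Qed.

Lemma eadj_sym E : symmetric (eadj E).
Proof. by move=> x y; rewrite /eadj setUC. Qed.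

Lemma econnect_sym E : connect_sym (eadj E).
Proof. exact/sym_connect_sym/eadj_sym. Qed.

Lemma connect_pair E u v x y : [set u; v] = [set x; y] ->
  connect (eadj E) u v -> connect (eadj E) x y.
Proof.
move=> uvxy cuv; have := set21 x y; have := set22 x y; rewrite -uvxy !inE.
by case/pred2P=> ->; case/pred2P=> ->; rewrite ?connect0 // econnect_sym.
Qed.

Lemma eadjS E F : E \subset F -> subrel (eadj E) (eadj F).
Proof. by move=> /subsetP sEF x y /sEF. Qed.

Lemma econnectS E F : E \subset F ->
  subrel (connect (eadj E)) (connect (eadj F)).
Proof. by move=> sEF; apply: connect_sub => x y /(eadjS sEF)/connect1. Qed.

Lemma eacyclicS E F : E \subset F -> eacyclic F -> eacyclic E.
Proof.
move=> sEF acF c Uc c3; apply: contra (acF c Uc c3).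
exact/sub_cycle/eadjS.
Qed.

Lemma connect_neigh E x y : connect (eadj E) x y -> x != y ->
  exists z, eadj E x z.
Proof.
case/connectP=> [[|z p] /= + ->]; first by rewrite eqxx.
by case/andP=> xz _; exists z.
Qed.

Lemma ecomp_eq E x y : connect (eadj E) x y -> ecomp E x = ecomp E y.
Proof.
by move=> xy; apply/setP=> z; rewrite !inE (same_connect (@econnect_sym E) xy).
Qed.

Lemma mem_ecomp E x y : (x \in ecomp E y) = (ecomp E y == ecomp E x).
Proof.
rewrite inE; apply/idP/eqP=> [/ecomp_eq // | /setP/(_ x)].
by rewrite !inE connect0.
Qed.

Lemma ecomps_eq E C x : C \in ecomps E -> x \in C -> C = ecomp E x.
Proof. by case/imsetP=> z _ ->; rewrite mem_ecomp => /eqP. Qed.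

Lemma ecomp_sub E x : edges_on E -> x \in V -> ecomp E x \subset V.
Proof.
move=> onE Vx; apply/subsetP=> y; rewrite inE => /connectP[p + ->].
elim: p x Vx => //= y' p IHp x _ /andP[/(edge_ends onE)[_ _ Vy']].
exact: IHp.
Qed.

(** Adding an edge between two components closes no cycle: otherwise the rest
    of the cycle would join the ends of that edge inside [E]. *)
Lemma eacyclicU1 E x y : eacyclic E -> ~~ connect (eadj E) x y ->
  eacyclic ([set x; y] |: E).
Proof.
move=> acE ncxy c Uc c3; apply/negP=> cyc.
have [/allP allE | /allPn[a ca nab]] :=
  boolP (all (fun z => eadj E z (next c z)) c).
  by case/negP: (acE c Uc c3); apply: cycle_from_next.
have ab := next_cycle cyc ca; move: ab nab cyc c3 (Uc).
have [i c' def_c] := rot_to ca.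
rewrite -(next_rot i Uc) -(rot_cycle i) -(size_rot i) -(rot_uniq i) def_c.
case: c' {def_c} => [|b [|d p]] //=; rewrite eqxx.
rewrite {1}/eadj in_setU1 => /orP[/eqP def_ab _ | /[swap]/negP//].
move=> /and3P[_ bd dpa] _ /and3P[].
rewrite !inE !negb_or => /and3P[nab nad nap] /andP[nbd nbp] _.
have in_E u v : u != a -> u != b -> eadj ([set x; y] |: E) u v -> eadj E u v.
  move=> ua ub; rewrite {1}/eadj in_setU1 => /predU1P[uv | //].
  by have:= set21 u v; rewrite uv -def_ab !inE (negPf ua) (negPf ub).
(* The cycle is a, b, d, p. After removal of its edge ab, every edge left has an
   end other than a and b, hence is not the new edge. *)
have ba : connect (eadj E) b a.
  apply: (@connect_trans _ _ d).
    by apply: connect1; rewrite eadj_sym in_E 1?eq_sym // eadj_sym.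
  have npx u : u \in p -> (u != a) && (u != b).
    by move=> pu; rewrite (memPn nap) // (memPn nbp).
  elim: p d nad nbd npx dpa {nap nbp bd} => [|u p IHp] d nad nbd npx /=.
    by rewrite andbT => /in_E-/(_ _ _)/connect1-> //; rewrite eq_sym.
  have /andP[ua ub] := npx u (mem_head _ _).
  case/andP=> /in_E-/(_ _ _)/connect1/connect_trans du pa.
  apply: du; rewrite 1?eq_sym //; apply: IHp => //; rewrite 1?eq_sym //.
  by move=> v pv; apply: npx; rewrite inE pv orbT.
case/negP: ncxy; apply: connect_pair ba; rewrite -def_ab; exact: setUC.
Qed.

Lemma connect_U1 E x y z : connect (eadj ([set x; y] |: E)) x z =
  (z \in ecomp E x :|: ecomp E y).
Proof.
apply/idP/idP; last first.
  have E1: connect (eadj ([set x; y] |: E)) x y.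
    by apply: connect1; rewrite /eadj setU11.
  rewrite !inE => /orP[]/(econnectS (subsetU1 [set x; y] E)) //.
  exact: connect_trans.
suff closedD w p : w \in ecomp E x :|: ecomp E y ->
    path (eadj ([set x; y] |: E)) w p -> last w p \in ecomp E x :|: ecomp E y.
  by case/connectP=> p + ->; apply: closedD; rewrite !inE connect0.
elim: p w => //= u p IHp w Dw /andP[wu]; apply: IHp.
move: wu; rewrite /eadj in_setU1 => /predU1P[wu|wu].
  have: u \in [set x; y] by rewrite -wu set22.
  by rewrite !inE => /pred2P[]->; rewrite connect0 ?orbT.
move: Dw; rewrite !inE => /orP[]/connect_trans->; rewrite ?orbT //;
  exact: connect1.
Qed.

(** A path that starts outside the two merged components never reaches the new
    edge. *)
Lemma ecompU1_other E x y z : z \notin ecomp E x :|: ecomp E y ->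
  ecomp ([set x; y] |: E) z = ecomp E z.
Proof.
move=> nDz; apply/setP=> w; rewrite !inE; apply/idP/idP; last first.
  exact/econnectS/subsetU1.
case/connectP=> p + ->.
elim: p z nDz => [|u p IHp] z nDz /=; first by rewrite connect0.
case/andP; rewrite {1}/eadj in_setU1 => /predU1P[zu | zu pu].
  have: z \in [set x; y] by rewrite -zu set21.
  move: nDz; rewrite !inE negb_or => /andP[nxz nyz] /pred2P[] zE.
    by rewrite zE connect0 in nxz.
  by rewrite zE connect0 in nyz.
apply: connect_trans (connect1 zu) (IHp u _ pu).
apply: contra nDz; rewrite !inE !(econnect_sym _ _ u) !(econnect_sym _ _ z).
by case/orP=> /(connect_trans (connect1 zu))->; rewrite ?orbT.
Qed.

(** The two components are merged and the others are unchanged, so that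
    sending the first to the union maps the old components other than the
    second bijectively onto the new ones. *)
Lemma card_ecompsU1 E x y : x \in V -> y \in V -> ~~ connect (eadj E) x y ->
  #|ecomps ([set x; y] |: E)|.+1 = #|ecomps E|.
Proof.
move=> Vx Vy ncxy; set D := ecomp E x :|: ecomp E y.
have Dx : ecomp ([set x; y] |: E) x = D.
  by apply/setP=> z; rewrite -connect_U1 inE.
have DE z : z \in D -> ecomp ([set x; y] |: E) z = D.
  by rewrite -Dx => Dz; apply/esym/eqP; rewrite -mem_ecomp.
pose merge C := if C == ecomp E x then D else C.
have CE z : z \in V -> ecomp E z \in ecomps E by move=> Vz; apply: imset_f.
have xNy : ecomp E x != ecomp E y.
  by apply: contra ncxy; rewrite eq_sym -mem_ecomp inE econnect_sym.
have ->: ecomps ([set x; y] |: E) = merge @: (ecomps E :\ ecomp E y).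
  apply/setP=> C; apply/imsetP/imsetP=> [[z Vz ->] | [C']].
    have [Dz | nDz] := boolP (z \in D).
      exists (ecomp E x); first by rewrite in_setD1 xNy CE.
      by rewrite /merge eqxx DE.
    move: (nDz); rewrite !inE !negb_or => /andP[nxz nyz].
    exists (ecomp E z).
      by rewrite in_setD1 CE // andbT eq_sym -mem_ecomp inE.
    by rewrite ecompU1_other // /merge eq_sym -mem_ecomp inE (negPf nxz).
  rewrite in_setD1 => /andP[nC'y /imsetP[z Vz def_C']] ->; rewrite /merge.
  have [_ | nC'x] := eqVneq; first by exists x.
  exists z => //; rewrite ecompU1_other // in_setU !mem_ecomp.
  by rewrite -def_C' ![_ == C']eq_sym (negPf nC'x) (negPf nC'y).
have nD C : C \in ecomps E :\ ecomp E y -> C <> D.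
  rewrite in_setD1 => /andP[/eqP nCy EC] CD; case: nCy; apply: ecomps_eq EC _.
  by rewrite CD !inE connect0 orbT.
rewrite card_in_imset; first by rewrite [RHS](cardsD1 (ecomp E y)) CE.
move=> C C' EC EC'; rewrite /merge; case: eqVneq => [->|_]; case: eqVneq => //.
  by move=> _ /esym/(nD _ EC').
by move=> _ /(nD _ EC).
Qed.

(** Adding an edge of [E] that joins two components merges them, so this can
    be repeated until the components are those of [E]. *)
Lemma extend_forest E0 E : edges_on E -> E0 \subset E -> eacyclic E0 ->
  exists F,
    [/\ F \subset E, eacyclic (E0 :|: F),
        connect (eadj (E0 :|: F)) =2 connect (eadj E),
        #|F| + #|ecomps E| = #|ecomps E0|
      & forall x y, [set x; y] \in F -> ~~ connect (eadj E0) x y].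
Proof.
move=> onE; have [n] := ubnP #|E :\: E0|.
elim: n E0 => // n IHn E0 leEn sE0E acE0.
have [/forallP allE | /forallPn[x /forallPn[y]]] := boolP
    [forall x, forall y, eadj E x y ==> connect (eadj E0) x y].
  have eqE : connect (eadj E0) =2 connect (eadj E).
    move=> x y; apply/idP/idP; first exact: econnectS.
    by apply: connect_sub => u v; move/forallP: (allE u) => /(_ v)/implyP.
  exists set0; rewrite setU0 cards0 add0n; split=> //.
  - exact: sub0set.
  - congr #|pred_of_set _|; apply: eq_imset => x.
    by apply/setP=> y; rewrite !inE eqE.
  - by move=> x y; rewrite inE.
rewrite negb_imply => /andP[Exy ncxy].
have [_ Vx Vy] := edge_ends onE Exy.
have nE0 : [set x; y] \notin E0 by apply: contra ncxy; apply: connect1.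
have sE1E : [set x; y] |: E0 \subset E by rewrite subUset sub1set sE0E andbT.
have [|F [sFE acF eqF cardF ncF]] := IHn _ _ sE1E (eacyclicU1 acE0 ncxy).
  rewrite setUC -setDDl; move: leEn; rewrite (cardsD1 [set x; y] (_ :\: _)).
  by rewrite in_setD nE0 [_ \in E]Exy.
have nF : [set x; y] \notin F.
  by apply/negP=> /ncF/negP[]; apply: connect1; apply: setU11.
exists ([set x; y] |: F); rewrite setUCA setUA; split=> //.
- by rewrite subUset sub1set sFE andbT.
- by rewrite cardsU1 nF -addnA cardF add1n card_ecompsU1.
- move=> u v /setU1P[uv | /ncF]; last exact/contra/econnectS/subsetU1.
  by apply: contra ncxy; apply: connect_pair.
Qed.

End EdgeSets.

Lemma eacyclic0 (U : finType) : eacyclic (set0 : {set {set U}}).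
Proof. by case=> [|x [|y c]] //= _ _; rewrite /eadj inE. Qed.

(** * The components of a forest as trees *)

Section Pieces.
Variables (U : finType) (V : {set U}) (F : {set {set U}}).
Hypothesis onF : edges_on V F.

Definition piece_edges (C : {set U}) := [set e in F | e \subset C].

Lemma piece_edges_on C : edges_on C (piece_edges C).
Proof.
by apply/forall_inP=> e; rewrite inE => /andP[/(forall_inP onF)/andP[-> _] ->].
Qed.

Definition piece C : graph U := Graph (piece_edges_on C).

Lemma piece_adj C x y : C \in ecomps V F -> x \in C ->
  adj (piece C) x y = eadj F x y.
Proof.
move=> FC Cx; rewrite /adj inE subUset !sub1set Cx (ecomps_eq FC Cx) inE.
by apply/andb_idr=> xy; apply: connect1.
Qed.

Lemma piece_sub C : C \in ecomps V F -> C \subset V.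
Proof. by case/imsetP=> x Vx ->; apply: ecomp_sub. Qed.

Lemma piece_neigh C x y : C \in ecomps V F -> x \in C -> eadj F x y -> y \in C.
Proof. by move=> FC Cx xy; rewrite (ecomps_eq FC Cx) inE connect1. Qed.

Lemma piece_tree C : eacyclic F -> C \in ecomps V F -> tree (piece C).
Proof.
move=> acF FC; split; last first.
  by apply: eacyclicS acF; apply/subsetP=> e; rewrite inE => /andP[].
split=> [|x y Cx Cy].
  by case/imsetP: FC => x _ ->; apply/set0Pn; exists x; rewrite inE.
have: y \in ecomp F x by rewrite -(ecomps_eq FC Cx).
rewrite inE => /connectP[p + ->] {y Cy}.
elim: p x Cx => [|z p IHp] x Cx //= /andP[xz pz].
apply: connect_trans (IHp z (piece_neigh FC Cx xz) pz).
by apply: connect1; rewrite piece_adj.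
Qed.

End Pieces.

(** * The edges that meet an independent [1,2]-set *)

(** When [S] is an independent [1,2]-set, every edge of [G] outside this
    bipartite subgraph is of type A as soon as the sets [X i] cover the
    complement of [S]. *)
Definition star_edges (U : finType) (G : graph U) (S : {set U}) :=
  [set e in eset G | ~~ (e \subset ~: S)].

Section StarEdges.
Variables (U : finType) (G : graph U) (S : {set U}).

Lemma star_edgesE x y :
  eadj (star_edges G S) x y = adj G x y && ((x \in S) || (y \in S)).
Proof. by rewrite /eadj inE subUset !sub1set !inE negb_and !negbK. Qed.

Lemma star_edges_neigh x : connected_graph G -> 2 <= #|vset G| ->
  independent12 G S -> x \in vset G -> exists z, eadj (star_edges G S) x z.
Proof.
move=> [_ conG] G2 [_ S12] Vx.
have [Sx | nSx] := boolP (x \in S); last first.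
  have /S12/andP[/card_gt0P[z] + _] : x \in vset G :\: S.
    by rewrite in_setD nSx.
  by rewrite !inE => /andP[xz Sz]; exists z; rewrite star_edgesE xz Sz orbT.
have [y] : exists y, y \in vset G :\ x.
  by apply/card_gt0P; move: G2; rewrite (cardsD1 x) Vx.
rewrite in_setD1 eq_sym => /andP[nxy Vy].
have [z xz] := connect_neigh (conG _ _ Vx Vy) nxy.
by exists z; rewrite star_edgesE Sx [adj _ _ _]xz.
Qed.

Lemma star_edges_alt x y : independent G S -> eadj (star_edges G S) x y ->
  (y \in S) = (x \notin S).
Proof.
case=> _ indS; rewrite star_edgesE => /andP[xy].
have [Sx _ | //] := boolP (x \in S).
by apply/negP=> Sy; move: (indS x y Sx Sy); rewrite xy.
Qed.

End StarEdges.

(** * The spanning tree *)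

Theorem theorem1 (U : finType) (G : graph U)
    (G_connected : connected_graph G) (G_nontrivial : 2 <= #|vset G|)
    (G_indep12 : exists S : {set U}, independent12 G S) :
  exists (T : graph U) (t : nat) (Ts : 'I_t -> graph U)
         (X Y : 'I_t -> {set U}),
    [/\ spanning_tree G T,
        F2 T,
        generating_family T Ts X Y,
        forall j, independent12 (Ts j) (Y j)
      & forall e, e \in eset G :\: eset T -> typeA X e \/ typeB Ts X Y e].
Proof.
have [S S12] := G_indep12; have [indS nS12] := S12.
set V := vset G; set E := eset G; set B := star_edges G S.
have onE : edges_on V E := esetP G.
have sBE : B \subset E by apply/subsetP=> e; rewrite inE => /andP[].
have onB := edges_onS sBE onE.
have [F0 []] := extend_forest onB (sub0set B) (@eacyclic0 U).
rewrite set0U => sF0B acF0 conF0 _ _.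
have sF0E := subset_trans sF0B sBE.
have onF0 := edges_onS sF0E onE.
have [F [sFE acT conT cardF ncF]] := extend_forest onE sF0E acF0.
have sTE : F0 :|: F \subset E by rewrite subUset sF0E.
pose T := Graph (edges_onS sTE onE : edges_on V (F0 :|: F)).
pose C (i : 'I_#|ecomps V F0|) : {set U} := enum_val i.
pose Ts i := piece onF0 (C i).
pose X i := C i :\: S; pose Y i := C i :&: S.
have FC i : C i \in ecomps V F0 by apply: enum_valP.
have Cx x : x \in V -> exists i, x \in C i.
  move=> Vx; have Fx : ecomp F0 x \in ecomps V F0 by apply: imset_f.
  by exists (enum_rank_in Fx (ecomp F0 x)); rewrite /C enum_rankK_in // inE.
have CV i x : x \in C i -> x \in V by apply/subsetP/(piece_sub onF0).
have neigh0 x : x \in V -> exists z, eadj F0 x z.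
  move=> Vx; have [z xz] := star_edges_neigh G_connected G_nontrivial S12 Vx.
  have [nxz _ _] := edge_ends onB xz.
  by apply: connect_neigh nxz; rewrite conF0 connect1.
have alt0 x y : eadj F0 x y -> (y \in S) = (x \notin S).
  by move/(eadjS sF0B); apply: star_edges_alt.
have sN i x : x \in X i -> nbrs (Ts i) x \subset nbrs G x :&: S.
  rewrite in_setD => /andP[nSx Cix]; apply/subsetP=> y.
  rewrite inE piece_adj // => xy.
  by rewrite !inE (alt0 _ _ xy) nSx andbT; apply: (eadjS sF0E).
have N2 i x : x \in X i -> #|nbrs G x :&: S| <= 2.
  rewrite in_setD => /andP[nSx /CV Vx].
  have /nS12/andP[//] : x \in vset G :\: S by rewrite in_setD nSx.
have sNi i x : x \in C i -> nbrs (Ts i) x \subset C i.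
  move=> Cix; apply/subsetP=> y; rewrite inE piece_adj //.
  exact: piece_neigh Cix.
have N0 i x : x \in C i -> 0 < #|nbrs (Ts i) x|.
  move=> Cix; have [z xz] := neigh0 x (CV _ _ Cix).
  by apply/card_gt0P; exists z; rewrite inE piece_adj.
have indY i : independent (Ts i) (Y i).
  split; first exact: subsetIl.
  move=> x y /setIP[Cix Sx] /setIP[Ciy Sy]; rewrite piece_adj //.
  by apply/negP=> /alt0; rewrite Sx Sy.
have p2 i : p2_bipartition (Ts i) (X i) (Y i).
  split; last first.
    by move=> x Xx; apply: leq_trans (subset_leq_card (sN i x Xx)) (N2 i x Xx).
  split=> //; first by rewrite setUC setID.
    by apply/pred0P=> x; rewrite /= !inE; case: (x \in S); rewrite ?andbF.
  split; first exact: subsetDl.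
  move=> x y /setDP[Cix nSx] /setDP[Ciy nSy]; rewrite piece_adj //.
  by apply/negP=> /alt0; rewrite (negPf nSy) nSx.
have treeT : tree T.
  split; last exact: acT.
  case: G_connected => V0 conG; split=> // x y Vx Vy.
  by rewrite conT; apply: conG.
have genT : generating_family T Ts X Y.
  split.
  - case: G_connected => /set0Pn[x Vx] _.
    by apply/card_gt0P; exists (ecomp F0 x); apply: imset_f.
  - move=> i; split=> //; split; first exact: piece_tree.
      have /imsetP[x Vx Cix] := FC i; have [z xz] := neigh0 x Vx.
      have [nxz _ _] := edge_ends onF0 xz.
      have Cx' : x \in C i by rewrite Cix inE.
      suff: [set x; z] \subset C i by move/subset_leq_card; rewrite cards2 nxz.
      by rewrite subUset !sub1set Cx'; apply: piece_neigh xz.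
    by exists (X i), (Y i).
  - move=> i j; apply: contraNT => /pred0Pn[x /= /andP[Cix Cjx]].
    apply/eqP/enum_val_inj; rewrite -!/(C _).
    by rewrite (ecomps_eq (FC i) Cix) (ecomps_eq (FC j) Cjx).
  - apply/setP=> x; apply/idP/bigcupP=> [/Cx[i Cix] | [i _ /CV //]].
    by exists i.
  exists F; split.
  - congr (_ :|: _); apply/setP=> e.
    apply/idP/bigcupP=> [F0e | [i _]]; last by rewrite inE => /andP[].
    have [x [y def_e]] := edge_pair onF0 F0e; rewrite def_e in F0e *.
    have [_ Vx _] := edge_ends onF0 F0e; have [i Cix] := Cx x Vx.
    by exists i => //; rewrite -[_ \in _]/(adj (Ts i) x y) piece_adj.
  - have -> : #|ecomps V F0| = #|F|.+1; last by rewrite subn1.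
    rewrite -cardF -addn1; congr (_ + _).
    case: G_connected => /set0Pn[x Vx] conG; apply/eqP/cards1P.
    exists (ecomp E x); apply/setP=> D; rewrite inE.
    apply/imsetP/eqP=> [[y Vy ->] | ->]; last by exists x.
    exact/esym/ecomp_eq/conG.
  move=> f Ff; have [x [y def_f]] := edge_pair (edges_onS sFE onE) Ff.
  rewrite def_f in Ff *; have [_ Vx Vy] := edge_ends (edges_onS sFE onE) Ff.
  have ncxy := ncF _ _ Ff.
  have [[i Cix] [j Cjy]] := (Cx x Vx, Cx y Vy).
  (* The ends are in different components of F0, which are those of B. *)
  have: ~~ eadj B x y by apply: contra ncxy => /connect1; rewrite conF0.
  rewrite star_edgesE [adj _ _ _](subsetP sFE _ Ff) negb_or => /andP[nSx nSy].
  exists i, j, x, y; rewrite !in_setD nSx nSy; split=> //.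
  apply: contraNneq ncxy => ij; rewrite -ij in Cjy.
  by move: Cjy; rewrite (ecomps_eq (FC i) Cix) inE.
exists T, #|ecomps V F0|, Ts, X, Y; split=> //.
- by split=> //; exists #|ecomps V F0|, Ts, X, Y.
- move=> i; split=> // v; rewrite in_setD /Y in_setI => /andP[+ Civ].
  rewrite [v \in C i]Civ => nSv; have Xv : v \in X i by rewrite in_setD nSv Civ.
  suff -> : nbrs (Ts i) v :&: (C i :&: S) = nbrs (Ts i) v.
    by rewrite N0 // (leq_trans (subset_leq_card (sN i v Xv))) ?(N2 i).
  apply/setIidPl; rewrite subsetI sNi //.
  exact: subset_trans (sN i v Xv) (subsetIr _ _).
move=> e; rewrite in_setD in_setU negb_or => /andP[/andP[F0e _] Ee].
have [x [y def_e]] := edge_pair onE Ee; rewrite {e}def_e in F0e Ee *.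
have typeB_of u v : eadj E u v -> ~~ eadj F0 u v -> u \notin S -> v \in S ->
    typeB Ts X Y [set u; v].
  move=> uv nF0uv nSu Sv; have [_ Vu Vv] := edge_ends onE uv.
  have [i Ciu] := Cx u Vu; have Xu : u \in X i by rewrite in_setD nSu.
  have Buv : eadj B u v by rewrite star_edgesE [adj _ _ _]uv Sv orbT.
  exists u, v, i; split=> //; last first.
    by rewrite in_setI Sv andbT (ecomps_eq (FC i) Ciu) inE conF0 connect1.
  (* The neighbours of u in its piece miss v, out of at most two in S. *)
  split=> //; apply/eqP; rewrite eqn_leq N0 // andbT -ltnS.
  apply: leq_trans (N2 i u Xu); apply: proper_card; rewrite properE sN //=.
  apply/subsetPn; exists v; first by rewrite !inE Sv andbT.
  by rewrite inE piece_adj.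
have [Sx | nSx] := boolP (x \in S); have [Sy | nSy] := boolP (y \in S).
- by case: indS => _ /(_ x y Sx Sy)/negP[].
- right; rewrite setUC; apply: typeB_of => //; by rewrite eadj_sym.
- by right; apply: typeB_of.
left; have [_ Vx Vy] := edge_ends onE Ee.
have [[i Cix] [j Cjy]] := (Cx x Vx, Cx y Vy).
rewrite /typeA subUset !sub1set; apply/andP; split; apply/bigcupP.
  by exists i; rewrite // in_setD nSx.
by exists j; rewrite // in_setD nSy.
Qed.
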